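(* Let $V:\mathbb{R}\to\mathbb{R}$ be infinitely differentiable and independent of $\varepsilon$, and for $0<\varepsilon\le 1$ let $A=-\varepsilon^{-1}V$ (multiplication operator) and $B=\varepsilon\,\partial_x^2$. Assume the operators have been discretised in space in such a way that the discretisation of $\partial_x$ has spectral radius $\rho_\varepsilon=\mathcal{O}(\varepsilon^{-1})$. Then every element $C$ of the Hall basis of the free Lie algebra on the two letters $A$ and $B$ (evaluated as a commutator of the operators $A$, $B$) either vanishes identically, $C\equiv 0$, or is $\mathcal{O}(\varepsilon^{-1})$, locally in $x$.
   Context: The commutator is $[X,Y]=XY-YX$. The Hall basis of the free Lie algebra generated by two letters $A,B$ is the standard basis consisting of iterated commutators: $A$, $B$, $[B,A]$, $[[B,A],A]$, $[[B,A],B]$, $\ldots$. When $A=-\varepsilon^{-1}V$ and $B=\varepsilon\partial_x^2$, every such iterated commutator is, by the product rule, a differential operator in the set $$\left\{\sum_{k=0}^K y_k(x)\partial_x^k : K\in\mathbb{Z}_+,\ y_0,\dots,y_K\in C^\infty(\mathbb{R})\right\},$$ where the $y_k$ may depend on $\varepsilon$. Meaning of ''size after discretisation'': $\partial_x$ is replaced by its discretisation, whose spectral radius $\rho_\varepsilon$ satisfies $\rho_\varepsilon\le c\,\varepsilon^{-1}$ for a constant $c$ independent of $\varepsilon\in(0,1]$, so that $\partial_x^k$ counts as a quantity of size $\rho_\varepsilon^k$. Coefficient functions are measured locally in $x$ (a smooth $V$ has all derivatives locally bounded, though they may be unbounded on $\mathbb{R}$). Thus an operator $C=\sum_{k=0}^K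 y_{k}(x;\varepsilon)\partial_x^k$ is said to be $\mathcal{O}(\varepsilon^{-1})$ if for every compact $I\subset\mathbb{R}$ there is a constant $M$, which may depend on $C$, $I$, $V$ and $c$ but not on $\varepsilon\in(0,1]$, such that $\sum_{k=0}^K \sup_{x\in I}|y_k(x;\varepsilon)|\,\rho_\varepsilon^k\le M\varepsilon^{-1}$. *)

(* Defs.v *)
From mathcomp Require Import all_boot all_order all_algebra.
From mathcomp Require Import all_classical all_reals all_analysis.
From mathcomp Require Import complex.

Set Implicit Arguments.
Unset Strict Implicit.
Unset Printing Implicit Defensive.

Import Order.TTheory GRing.Theory Num.Theory.
Import numFieldNormedType.Exports.

Local Open Scope classical_set_scope.
Local Open Scope ring_scope.

(* Non-associative monomials in two letters; [Bracket u v] stands for [u, v]. *)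
Inductive monomial : Type :=
| LetterA
| LetterB
| Bracket (u v : monomial).

Fixpoint degree (t : monomial) : nat :=
  if t is Bracket u v then (degree u + degree v)%N else 1%N.

(* The orders from which Hall bases with A < B are built. Within a given degree
   (above 1) the order is a free choice. *)
Record hall_order (le : rel monomial) : Prop := HallOrder {
  hall_order_total : total le;
  hall_order_anti : antisymmetric le;
  hall_order_trans : transitive le;
  hall_order_degree : forall u v, (degree u < degree v)%N -> le u v;
  hall_order_letters : le LetterA LetterB
}.

(* M. Hall's basic commutators: [u, v] is basic when u and v are basic, v < u,
   and v >= u2 in case u = [u1, u2]. In low degree these are A, B, [B, A],
   [[B, A], A], [[B, A], B]. Strict order v < u is [~~ le u v]. *)
Fixpoint hall_basis (le : rel monomial) (t : monomial) : Prop :=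
  if t is Bracket u v then
    [/\ hall_basis le u, hall_basis le v, ~~ le u v
      & if u is Bracket _ u2 then le u2 v else True]
  else True.

Definition smooth (R : realType) (f : R -> R) : Prop :=
  forall (n : nat) (x : R), derivable (derive1n n f) x 1.

(* Operators are maps on all functions, but only their values on smooth
   functions are meaningful: derivatives of other functions are junk. *)
Definition operator (R : realType) := (R -> R) -> (R -> R).

Definition commutator (R : realType) (X Y : operator R) : operator R :=
  fun f x => X (Y f) x - Y (X f) x.

Fixpoint eval_monomial (R : realType) (A B : operator R) (t : monomial) :
    operator R :=
  match t with
  | LetterA => A
  | LetterB => B
  | Bracket u v => commutator (eval_monomial A B u) (eval_monomial A B v)
  end.

Definition opA (R : realType) (V : R -> R) (eps : R) : operator R :=
  fun f x => - eps^-1 * V x * f x.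

Definition opB (R : realType) (eps : R) : operator R :=
  fun f x => eps * derive1n 2 f x.

Definition vanishes (R : realType) (C : R -> operator R) : Prop :=
  forall eps : R, 0 < eps <= 1 ->
  forall f : R -> R, smooth f -> forall x : R, C eps f x = 0.

(* C eps is the sum of y eps k * (d/dx)^k over 0 <= k <= K, with smooth
   coefficients; these are determined by the action on smooth functions. *)
Definition has_coefs (R : realType) (C : R -> operator R)
    (K : nat) (y : R -> nat -> R -> R) : Prop :=
  forall eps : R, 0 < eps <= 1 ->
    (forall k : nat, (k <= K)%N -> smooth (y eps k)) /\
    (forall f : R -> R, smooth f -> forall x : R,
       C eps f x = \sum_(k < K.+1) y eps k x * derive1n k f x).

(* The set is finite, and empty only for n = 0, when the value is 0. *)
Definition spectral_radius (R : realType) (n : nat) (D : 'M[R[i]]_n) : R :=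
  sup [set Normc.normc l | l in [set l : R[i] | eigenvalue D l]].

Definition discretised_size (R : realType) (I : set R)
    (K : nat) (y : nat -> R -> R) (rho : R) : R :=
  \sum_(k < K.+1) sup [set `|y k x| | x in I] * rho ^+ k.

(* "C is O(eps^-1), locally in x": the constant M is chosen before the family D
   of matrices discretising d/dx, so it depends on that family only through
   the constant c bounding its spectral radii. Since every nonnegative real is
   the spectral radius of some matrix, this covers any spatial discretisation. *)
Definition is_O_inv_eps (R : realType) (c : R) (C : R -> operator R) : Prop :=
  exists (K : nat) (y : R -> nat -> R -> R),
    has_coefs C K y /\
    forall I : set R, compact I ->
    exists M : R,
    forall (n : R -> nat) (D : forall eps : R, 'M[R[i]]_(n eps)),
      (forall eps : R, 0 < eps <= 1 ->
         spectral_radius (D eps) <= c * eps^-1) ->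
      forall eps : R, 0 < eps <= 1 ->
        discretised_size I K (y eps) (spectral_radius (D eps)) <= M * eps^-1.

(* Main.v *)
Require Import Defs.
From mathcomp Require Import all_boot all_order all_algebra.
From mathcomp Require Import all_classical all_reals all_analysis.
From mathcomp Require Import complex.
From mathcomp Require Import ring zify.

Set Implicit Arguments.
Unset Strict Implicit.
Unset Printing Implicit Defensive.

Import Order.TTheory GRing.Theory Num.Theory.
Import numFieldNormedType.Exports.

Local Open Scope ring_scope.

(** Each commutator loses one order of differentiation, and this balances the
    powers of [eps] in the letters. Let [a] and [b] be the numbers of letters A
    and B in [w]. Two facts are proved by induction on the iterated commutator
    [w] ([eval_monomial_diffop]).

    - Homogeneity: the value of [w] is [eps ^ (b - a)] times an operator [X]
      that does not depend on [eps].
    - Order: [X] has order at most [b - a + 1], where order [-1] means [X = 0].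
      The bound is 0 for A and 2 for B, and the bound for [Bracket u v] is one
      less than the sum of the bounds for [u] and [v]. So the inductive step is
      the classical fact that a commutator of differential operators of orders
      [p] and [q] has order at most [p + q - 1] ([diffop_commutator]): the
      top-order parts commute because
      multiplication of functions is commutative.

    If [b - a + 1 < 0], then [w] vanishes. Otherwise its terms are
    [eps ^ (b - a) * y_k * d^k/dx^k] with [k <= b - a + 1], and as the discrete
    derivative has size at most [c / eps], such a term has size at most a
    constant times [eps ^ (b - a - k)], where [b - a - k >= -1]
    ([power_count]). The coefficients [y_k] are continuous, hence bounded on
    compact sets. *)

(** * Calculus of smooth functions *)

Lemma smooth_derivable (R : realType) (f : R -> R) :
  smooth f -> forall x, derivable f x 1.
Proof. by move=> sf; apply: (sf 0). Qed.

Lemma smooth_derive1n (R : realType) (f : R -> R) (k : nat) :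
  smooth f -> smooth (derive1n k f).
Proof. by move=> sf n x; have := sf (n + k)%N x; rewrite /derive1n iterD. Qed.

Lemma smooth_derive1 (R : realType) (f : R -> R) :
  smooth f -> smooth (derive1 f).
Proof. exact: (@smooth_derive1n R f 1). Qed.

Lemma derive1_add (R : realType) (f g : R -> R) :
  (forall x, derivable f x 1) -> (forall x, derivable g x 1) ->
  derive1 (f + g) = derive1 f + derive1 g.
Proof.
move=> df dg; apply/funext => x; rewrite [RHS]/GRing.add /= !derive1E.
by rewrite deriveD.
Qed.

Lemma derive1_mul (R : realType) (f g : R -> R) :
  (forall x, derivable f x 1) -> (forall x, derivable g x 1) ->
  derive1 (f * g) = derive1 f * g + f * derive1 g.
Proof.
move=> df dg; apply/funext => x; rewrite !fctE !derive1E deriveM //.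
by rewrite addrC; congr (_ + _); rewrite /GRing.scale /= mulrC.
Qed.

Lemma derive1n_add (R : realType) (f g : R -> R) (k : nat) :
  smooth f -> smooth g ->
  derive1n k (f + g) = derive1n k f + derive1n k g.
Proof.
move=> sf sg; elim: k => // k IHk; rewrite !derive1nS IHk derive1_add //.
Qed.

Lemma smooth_add (R : realType) (f g : R -> R) :
  smooth f -> smooth g -> smooth (f + g).
Proof. by move=> sf sg n x; rewrite derive1n_add //; apply: derivableD. Qed.

(** A class that contains the products and that the Leibniz rule keeps stable
    under differentiation. All iterated derivatives of [f * g] belong to it,
    hence are differentiable, and no formula for them is required. *)
Inductive sum_of_products (R : realType) : (R -> R) -> Prop :=
| SumOfProductsMul f g : smooth f -> smooth g -> sum_of_products (f * g)
| SumOfProductsAdd h1 h2 :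
    sum_of_products h1 -> sum_of_products h2 -> sum_of_products (h1 + h2).

Lemma derive1_sum_of_products (R : realType) (h : R -> R) :
  sum_of_products h ->
  (forall x, derivable h x 1) /\ sum_of_products (derive1 h).
Proof.
elim=> [f g sf sg|h1 h2 _ [d1 S1] _ [d2 S2]]; split.
- by move=> x; apply: derivableM; exact: smooth_derivable.
- rewrite derive1_mul; [|exact: smooth_derivable..].
  exact: (SumOfProductsAdd (SumOfProductsMul (smooth_derive1 sf) sg)
                            (SumOfProductsMul sf (smooth_derive1 sg))).
- by move=> x; apply: derivableD.
- by rewrite derive1_add //; apply: SumOfProductsAdd.
Qed.

Lemma smooth_mul (R : realType) (f g : R -> R) :
  smooth f -> smooth g -> smooth (f * g).
Proof.
move=> sf sg n.
have : sum_of_products (derive1n n (f * g)).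
  elim: n => [|n IHn]; first exact: SumOfProductsMul.
  by rewrite derive1nS; have [] := derive1_sum_of_products IHn.
by case/derive1_sum_of_products.
Qed.

Lemma smooth_cst (R : realType) (a : R) : smooth (cst a : R -> R).
Proof.
move=> n x.
suff -> : derive1n n (cst a : R -> R) = cst (if n is 0 then a else 0).
  exact: derivable_cst.
elim: n => // n IHn; rewrite derive1nS IHn; apply/funext => y.
exact: derive1_cst.
Qed.

Lemma derive1n_scale (R : realType) (a : R) (f : R -> R) (k : nat) :
  smooth f -> derive1n k (a *: f) = a *: derive1n k f.
Proof.
move=> sf; elim: k => // k IHk; rewrite !derive1nS IHk.
apply/funext => x; rewrite [RHS]/GRing.scale /= !derive1E deriveZ //.
Qed.

Lemma smooth_scale (R : realType) (a : R) (f : R -> R) :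
  smooth f -> smooth (a *: f).
Proof. by move=> sf n x; rewrite derive1n_scale //; apply: derivableZ. Qed.

Lemma smooth0 (R : realType) : smooth (0 : R -> R).
Proof.
by rewrite -(scale0r (cst 0)); apply: smooth_scale; exact: smooth_cst.
Qed.

Lemma smooth_opp (R : realType) (f : R -> R) : smooth f -> smooth (- f).
Proof. by move=> sf; rewrite -scaleN1r; exact: smooth_scale. Qed.

(** * Differential operators filtered by order *)

(** [diffop n X] says that on smooth functions [X] is a sum of terms
    [y * d^k/dx^k] with [k < n]. The bound is strict so that [n = 0] is the
    case of the zero operator, whose order counts as negative. Building the sum
    term by term reduces each statement that is linear in [X] to one term. *)
Inductive diffop (R : realType) (n : nat) : operator R -> Prop :=
| DiffopZero : diffop n (fun _ => 0)
| DiffopTerm y k X : smooth y -> (k < n)%N -> diffop n X ->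
    diffop n (fun f => y * derive1n k f + X f)
| DiffopExt X Y : (forall f, smooth f -> X f = Y f) -> diffop n X ->
    diffop n Y.

Lemma diffop_monomial (R : realType) (n k : nat) (y : R -> R) :
  smooth y -> (k < n)%N -> diffop n (fun f => y * derive1n k f).
Proof.
move=> sy kn; apply: DiffopExt (DiffopTerm sy kn (DiffopZero _ n)) => f _.
by rewrite addr0.
Qed.

Lemma diffop_smooth (R : realType) (n : nat) (X : operator R) :
  diffop n X -> forall f, smooth f -> smooth (X f).
Proof.
elim=> [|y k {}X sy _ _ IH|{}X Y XY _ IH] f sf.
- exact: smooth0.
- exact: (smooth_add (smooth_mul sy (smooth_derive1n sf)) (IH f sf)).
- by rewrite -(XY f sf); exact: IH.
Qed.

(** Without smoothness additivity may fail: the derivative of a function that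
    is not differentiable is an unspecified value. *)
Lemma diffop_apply_add (R : realType) (n : nat) (X : operator R) :
  diffop n X ->
  forall f g, smooth f -> smooth g -> X (f + g) = X f + X g.
Proof.
elim=> [|y k {}X _ _ _ IH|{}X Y XY _ IH] f g sf sg.
- by rewrite addr0.
- rewrite (derive1n_add k sf sg) (IH f g sf sg); ring.
- rewrite -(XY f sf) -(XY g sg) -(IH f g sf sg).
  by rewrite (XY _ (smooth_add sf sg)).
Qed.

Lemma diffop_apply_scale (R : realType) (n : nat) (X : operator R) :
  diffop n X -> forall (a : R) f, smooth f -> X (a *: f) = a *: X f.
Proof.
elim=> [|y k {}X _ _ _ IH|{}X Y XY _ IH] a f sf.
- by rewrite scaler0.
- rewrite (derive1n_scale a k sf) (IH a f sf).
  by apply/funext => x; rewrite !fctE /GRing.scale /=; ring.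
- by rewrite -(XY f sf) -(IH a f sf) (XY _ (smooth_scale sf)).
Qed.

Lemma diffop_widen (R : realType) (m n : nat) (X : operator R) :
  (m <= n)%N -> diffop m X -> diffop n X.
Proof.
move=> mn; elim=> [|y k {}X sy km _ IH|{}X Y XY _ IH].
- exact: DiffopZero.
- by apply: DiffopTerm => //; exact: leq_trans mn.
- exact: DiffopExt XY IH.
Qed.

Lemma diffop_add (R : realType) (n : nat) (X Y : operator R) :
  diffop n X -> diffop n Y -> diffop n (fun f => X f + Y f).
Proof.
move=> + PY; elim=> [|y k {}X sy kn _ IH|{}X Z XZ _ IH].
- by apply: DiffopExt PY => f _; rewrite add0r.
- by apply: DiffopExt (DiffopTerm sy kn IH) => f _; rewrite addrA.
- by apply: DiffopExt IH => f sf; rewrite (XZ f sf).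
Qed.

Lemma diffop_mull (R : realType) (n : nat) (z : R -> R) (X : operator R) :
  smooth z -> diffop n X -> diffop n (fun f => z * X f).
Proof.
move=> sz; elim=> [|y k {}X sy kn _ IH|{}X Y XY _ IH].
- by apply: DiffopExt (DiffopZero _ n) => f _; rewrite mulr0.
- apply: DiffopExt (DiffopTerm (smooth_mul sz sy) kn IH) => f _.
  by rewrite mulrDr mulrA.
- by apply: DiffopExt IH => f sf; rewrite (XY f sf).
Qed.

Lemma diffop_opp (R : realType) (n : nat) (X : operator R) :
  diffop n X -> diffop n (fun f => - X f).
Proof.
move=> PX; apply: DiffopExt (diffop_mull (@smooth_cst R (-1)) PX) => f _.
by apply/funext => x; rewrite !fctE mulN1r.
Qed.

Lemma diffop_derive1 (R : realType) (n : nat) (X : operator R) :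
  diffop n X -> diffop n.+1 (fun f => derive1 (X f)).
Proof.
elim=> [|y k {}X sy kn PX IH|{}X Y XY _ IH].
- apply: DiffopExt (DiffopZero _ _) => f _; apply/funext => x.
  by rewrite [RHS]derive1_cst.
- have sy' : smooth (derive1 y) by exact: smooth_derive1.
  apply: DiffopExt (DiffopTerm sy' (ltnW kn : k < n.+1)%N
    (DiffopTerm sy (kn : k.+1 < n.+1)%N IH)) => f sf.
  have skf : smooth (derive1n k f) := smooth_derive1n sf.
  have sXf := diffop_smooth PX sf.
  rewrite (derive1_add (smooth_derivable (smooth_mul sy skf))
                       (smooth_derivable sXf)).
  rewrite (derive1_mul (smooth_derivable sy) (smooth_derivable skf)).
  by rewrite derive1nS addrA.
- by apply: DiffopExt IH => f sf; rewrite (XY f sf).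
Qed.

Lemma diffop_comp_derive1n (R : realType) (n k : nat) (X : operator R) :
  diffop n X -> diffop (n + k) (fun f => X (derive1n k f)).
Proof.
elim=> [|y i {}X sy lt_in _ IH|{}X Y XY _ IH].
- exact: DiffopZero.
- have lt_ik : (i + k < n + k)%N by rewrite ltn_add2r.
  apply: DiffopExt (DiffopTerm sy lt_ik IH) => f _.
  by rewrite /derive1n iterD.
- by apply: DiffopExt IH => f sf; rewrite (XY _ (smooth_derive1n sf)).
Qed.

(** The commutator of [y] with the derivation is [- y'], of order 0. Each
    further derivative raises the order by one, according to
    [[y, d^(k+1)] = d [y, d^k] - y' d^k]. *)
Lemma commutator_mul_derive1n (R : realType) (y : R -> R) (k : nat) :
  smooth y -> diffop k (commutator (fun f => y * f) (derive1n k)).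
Proof.
move=> sy; elim: k => [|k IHk].
  apply: DiffopExt (DiffopZero _ 0) => f _.
  by apply/funext => x; rewrite [RHS]subrr.
have sy' : smooth (- derive1 y) by apply: smooth_opp; exact: smooth_derive1.
apply: DiffopExt (DiffopTerm sy' (ltnSn k) (diffop_derive1 IHk)) => f sf.
have -> : commutator (fun f => y * f) (derive1n k) f =
    y * derive1n k f + - derive1n k (y * f) by [].
have skf : smooth (derive1n k f) := smooth_derive1n sf.
have skyf : smooth (derive1n k (y * f)) := smooth_derive1n (smooth_mul sy sf).
rewrite (derive1_add (smooth_derivable (smooth_mul sy skf))
                     (smooth_derivable (smooth_opp skyf))).
rewrite (derive1_mul (smooth_derivable sy) (smooth_derivable skf)).
have -> : derive1 (- derive1n k (y * f)) = - derive1n k.+1 (y * f).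
  apply/funext => x; rewrite [RHS]/GRing.opp /= !derive1E deriveN //.
  exact: (smooth_derivable skyf).
rewrite -derive1nS /commutator; apply/funext => x; rewrite !fctE; ring.
Qed.

(** The commutator of [y d^k] and [z d^i] is
    [z [y, d^i] d^k - y [z, d^k] d^i]: the two products of order [k + i] have
    the same leading coefficient [y z], so they cancel there. *)
Lemma commutator_monomials (R : realType) (y z : R -> R) (k i : nat) :
  smooth y -> smooth z ->
  diffop (k + i)
    (commutator (fun f => y * derive1n k f) (fun f => z * derive1n i f)).
Proof.
move=> sy sz.
have T1 := diffop_opp
  (diffop_mull sy (diffop_comp_derive1n i (commutator_mul_derive1n k sz))).
have T2 :=
  diffop_mull sz (diffop_comp_derive1n k (commutator_mul_derive1n i sy)).
rewrite addnC in T2.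
apply: DiffopExt (diffop_add T1 T2) => f _; rewrite /commutator.
have -> : derive1n k (derive1n i f) = derive1n i (derive1n k f).
  by rewrite /derive1n -!iterD addnC.
apply/funext => x; rewrite !fctE; ring.
Qed.

(** The condition on [p] is only asked when [Y] may be nonzero: the commutator
    with the zero operator is zero, whatever the other order. *)
Lemma commutator_monomial_diffop (R : realType) (n k p : nat) (y : R -> R)
    (Y : operator R) :
  ((0 < n)%N -> (k + n <= p + 1)%N) -> smooth y -> diffop n Y ->
  diffop p (commutator (fun f => y * derive1n k f) Y).
Proof.
move=> knp sy; elim=> [|z i {}Y sz lt_in PY IHY|{}Y Z YZ PY IHY].
- apply: DiffopExt (DiffopZero _ _) => f sf; rewrite /commutator.
  have := derive1n_scale 0 k (@smooth0 R); rewrite !scale0r => D0.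
  by apply/funext => x; rewrite [derive1n _ 0]D0 fctE mulr0 subrr.
- have le_ki : (k + i <= p)%N by lia.
  have T := diffop_widen le_ki (commutator_monomials k i sy sz).
  apply: DiffopExt (diffop_add T IHY) => f sf; rewrite /commutator.
  have szf : smooth (z * derive1n i f) := smooth_mul sz (smooth_derive1n sf).
  rewrite (derive1n_add k szf (diffop_smooth PY sf)).
  by apply/funext => x; rewrite !fctE; ring.
- apply: DiffopExt IHY => f sf; rewrite /commutator (YZ f sf).
  by rewrite (YZ _ (smooth_mul sy (smooth_derive1n sf))).
Qed.

(** Strict bounds [m] and [n] on the orders give [m + n - 2] as a strict bound
    on the order of the commutator. If [m] or [n] is zero, then the commutator
    is the zero operator and any [p] will do. *)
Lemma diffop_commutator (R : realType) (m n p : nat) (X Y : operator R) :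
  ((0 < m)%N -> (0 < n)%N -> (m + n <= p + 2)%N) ->
  diffop m X -> diffop n Y -> diffop p (commutator X Y).
Proof.
move=> mnp PX PY; elim: PX => [|y k {}X sy km PX IHX|{}X Z XZ PX IHX].
- apply: DiffopExt (DiffopZero _ _) => f sf; rewrite /commutator.
  have := diffop_apply_scale PY 0 (@smooth0 R); rewrite !scale0r => Y0.
  by apply/funext => x; rewrite [Y _]Y0 subrr.
- have knp : (0 < n)%N -> (k + n <= p + 1)%N by lia.
  have T := commutator_monomial_diffop knp sy PY.
  apply: DiffopExt (diffop_add T IHX) => f sf; rewrite /commutator.
  have syf : smooth (y * derive1n k f) := smooth_mul sy (smooth_derive1n sf).
  rewrite (diffop_apply_add PY syf (diffop_smooth PX sf)).
  by apply/funext => x; rewrite !fctE; ring.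
- apply: DiffopExt IHX => f sf; rewrite /commutator (XZ f sf).
  by rewrite (XZ _ (diffop_smooth PY sf)).
Qed.

Lemma diffop_coefs (R : realType) (n : nat) (X : operator R) :
  diffop n X ->
  exists y : nat -> R -> R, (forall k, smooth (y k)) /\
    forall f, smooth f -> forall x,
      X f x = \sum_(k < n) y k x * derive1n k f x.
Proof.
elim=> [|z k {}X sz kn _ [y [sy Xy]]|{}X Y XY _ [y [sy Xy]]].
- exists (fun _ => 0); split=> [_|f _ x]; first exact: smooth0.
  by rewrite big1 // => i _; rewrite mul0r.
- exists (fun i => if i == k then z + y i else y i); split=> [i|f sf x].
    by case: (i == k); [exact: smooth_add sz (sy i)|exact: sy].
  rewrite (bigD1 (Ordinal kn)) //= eqxx.
  have -> : (z * derive1n k f + X f) x = z x * derive1n k f x + X f x by [].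
  rewrite (Xy f sf).
  rewrite (bigD1 (Ordinal kn)) //= !fctE mulrDl addrA; congr (_ + _).
  by apply: eq_bigr => i /negbTE; rewrite -val_eqE /= => ->.
- by exists y; split=> // f sf x; rewrite -XY // Xy.
Qed.

(** * Iterated commutators of the two letters *)

Fixpoint count_A (t : monomial) : nat :=
  match t with
  | LetterA => 1
  | LetterB => 0
  | Bracket u v => count_A u + count_A v
  end.

Fixpoint count_B (t : monomial) : nat :=
  match t with
  | LetterA => 0
  | LetterB => 1
  | Bracket u v => count_B u + count_B v
  end.

(** The strict order bound is [b - a + 2]; the truncation of the subtraction at
    zero is right, as a negative value means that the operator vanishes. *)
Lemma eval_monomial_diffop (R : realType) (V : R -> R) (w : monomial) :
  smooth V ->
  exists X : operator R, diffop (count_B w + 2 - count_A w) X /\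
    forall eps f, smooth f ->
      eval_monomial (opA V eps) (opB eps) w f =
      (eps ^+ count_B w * eps^-1 ^+ count_A w) *: X f.
Proof.
move=> sV; elim: w => [||u [X [PX uX]] v [Y [PY vY]]] /=.
- exists (fun f => - V * derive1n 0 f); split.
    exact: diffop_monomial (smooth_opp sV) _.
  move=> eps f _; apply/funext => x; rewrite /opA !fctE /GRing.scale /=; ring.
- exists (fun f : R -> R => cst 1 * derive1n 2 f); split.
    exact: diffop_monomial (@smooth_cst R 1) _.
  move=> eps f _; apply/funext => x; rewrite /opB !fctE /GRing.scale /=; ring.
- exists (commutator X Y); split; last first.
    move=> eps f sf; have sXf := diffop_smooth PX sf.
    have sYf := diffop_smooth PY sf.
    rewrite /commutator (uX _ _ sf) (vY _ _ sf).
    rewrite (uX _ _ (smooth_scale sYf)) (vY _ _ (smooth_scale sXf)).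
    rewrite (diffop_apply_scale PX _ sYf) (diffop_apply_scale PY _ sXf).
    by apply/funext => x; rewrite !exprD !fctE /GRing.scale /=; ring.
  by apply: diffop_commutator PX PY => ? ?; lia.
Qed.

(** * Size in powers of the small parameter *)

Lemma sup_of_ge0_ge0 (R : realType) (S : set R) :
  (forall r, S r -> 0 <= r) -> 0 <= sup S.
Proof.
move=> S0; have [supS|/sup_out -> //] := pselect (has_sup S).
have [r Sr] := supS.1.
exact: le_trans (S0 r Sr) (ub_le_sup supS.2 Sr).
Qed.

Lemma spectral_radius_ge0 (R : realType) (n : nat) (D : 'M[R[i]]_n) :
  0 <= spectral_radius D.
Proof. by apply: sup_of_ge0_ge0 => _ [[a b] _ <-]; exact: sqrtr_ge0. Qed.

Lemma sup_norm_scale_le (R : realType) (I : set R) (y : R -> R) (e : R) :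
  compact I -> smooth y -> 0 <= e ->
  sup [set `|(e *: y) x| | x in I] <= e * sup [set `|y x| | x in I].
Proof.
move=> cI sy e0.
have [->|/set0P [x0 Ix0]] := eqVneq I set0.
  by rewrite !image_set0 !sup0 mulr0.
have bdd : has_ubound [set `|y x| | x in I].
  have cy : {within I, continuous y}%classic.
    apply: continuous_subspaceT => x.
    apply/differentiable_continuous/derivable1_diffP.
    exact: (smooth_derivable sy).
  have [M [_ yM]] := compact_bounded (continuous_compact cy cI).
  exists (M + 1) => _ [x Ix <-]; apply: (yM (M + 1)); first by rewrite ltrDl.
  by exists x.
apply: ge_sup; first by exists `|(e *: y) x0|, x0.
move=> _ [x Ix <-]; rewrite fctE /GRing.scale /= normrM (ger0_norm e0).
by apply: ler_wpM2l => //; apply: ub_le_sup => //; exists x.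
Qed.

(** After bounding [rho] by [c / eps], what remains is that
    [eps ^ (b - a - k)] is at most [1 / eps], which holds because [eps <= 1]
    and [b - a - k >= -1]. The bounds on [rho] force [c] to be nonnegative. *)
Lemma power_count (R : realType) (eps c rho : R) (a b k : nat) :
  0 < eps <= 1 -> 0 <= rho <= c * eps^-1 -> (a + k <= b + 1)%N ->
  eps ^+ b * eps^-1 ^+ a * rho ^+ k <= c ^+ k * eps^-1.
Proof.
move=> /andP[e0 e1] /andP[r0 rc] akb.
have ei0 : 0 <= eps^-1 by rewrite invr_ge0 ltW.
have c0 : 0 <= c.
  by have := le_trans r0 rc; rewrite pmulr_lge0 // invr_gt0.
apply: (@le_trans _ _ (eps ^+ b * eps^-1 ^+ a * (c * eps^-1) ^+ k)).
  apply: ler_wpM2l; first by rewrite mulr_ge0 // exprn_ge0 // ltW.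
  by apply: lerXn2r; rewrite ?nnegrE // (le_trans r0 rc).
rewrite exprMn (_ : _ * _ = c ^+ k * (eps ^+ b * eps^-1 ^+ (a + k))).
  apply: ler_wpM2l; first exact: exprn_ge0.
  rewrite exprVn ler_pdivrMr ?exprn_gt0 // mulrC ler_pdivlMr //.
  rewrite -exprSr; apply: ler_wiXn2l; rewrite ?(ltW e0) //; lia.
rewrite exprD; ring.
Qed.

Theorem theorem3 (R : realType) (V : R -> R) (hV : smooth V)
    (le : rel monomial) (hle : hall_order le)
    (w : monomial) (hw : hall_basis le w) (c : R) :
  let C := fun eps : R => eval_monomial (opA V eps) (opB eps) w in
  vanishes C \/ is_O_inv_eps c C.
Proof.
have [X [PX wX]] := eval_monomial_diffop w hV.
have [y [sy Xy]] := diffop_coefs PX.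
move: Xy; case order: (count_B w + 2 - count_A w)%N => [|K] Xy C.
  left=> eps _ f sf x.
  by rewrite /C wX // fctE Xy // big_ord0 scaler0.
right; pose e eps : R := eps ^+ count_B w * eps^-1 ^+ count_A w.
exists K, (fun eps k => e eps *: y k); split=> [eps _|I cI].
  split=> [k _|f sf x]; first exact: smooth_scale (sy k).
  rewrite /C wX // fctE Xy // scaler_sumr; apply: eq_bigr => k _.
  by rewrite fctE scalerAl.
exists (\sum_(k < K.+1) sup [set `|y k x| | x in I] * c ^+ k).
move=> n D rhoc eps eps01; rewrite /discretised_size mulr_suml.
set rho := spectral_radius _.
have rho0 : 0 <= rho by exact: spectral_radius_ge0.
have e0 : 0 <= e eps.
  by case/andP: eps01 => ep _; rewrite mulr_ge0 ?exprn_ge0 ?invr_ge0 ?ltW.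
apply: ler_sum => k _.
apply: (@le_trans _ _ (e eps * sup [set `|y k x| | x in I] * rho ^+ k)).
  by apply: ler_wpM2r; [exact: exprn_ge0|exact: sup_norm_scale_le cI (sy k) e0].
rewrite [e eps * _]mulrC -!(mulrA (sup _)); apply: ler_wpM2l.
  by apply: sup_of_ge0_ge0 => _ [x _ <-]; exact: normr_ge0.
apply: power_count => //; first by rewrite rho0 rhoc.
by have := ltn_ord k; lia.
Qed.
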